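(* Let $m,n\in\mathbb{N}$, and suppose that $C_0[0,\omega_1)^m$ is isomorphic to either a subspace or a quotient of $C_0[0,\omega_1)^n$. Then $m\le n$.
   Context: $\mathbb{N}$ is the set of positive integers. Scalars are in $\mathbb{K}=\mathbb{R}$ or $\mathbb{K}=\mathbb{C}$. $\omega_1$ is the first uncountable ordinal; $[0,\omega_1)$ carries the order topology. $C_0[0,\omega_1)$ is the Banach space (supremum norm) of continuous functions $[0,\omega_1)\to\mathbb{K}$ that vanish eventually; $C_0[0,\omega_1)^m$ is the direct sum of $m$ copies of it. Isomorphic means linearly homeomorphic; subspaces are closed, and quotients are by closed subspaces. *)

(* Defs.v *)
From HB Require Import structures.
From mathcomp Require Import all_boot all_order all_algebra.
From mathcomp.real_closed Require Import complex.
From mathcomp Require Import all_classical all_reals all_analysis.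
From mathcomp Require Import wochoice.
Set Implicit Arguments.
Unset Strict Implicit.
Unset Printing Implicit Defensive.
Import Order.TTheory GRing.Theory Num.Theory.
Import numFieldNormedType.Exports.
Local Open Scope classical_set_scope.
Local Open Scope ring_scope.

(* omega_1 is built as the set of elements with countably many predecessors *)
(* in some well-order of the uncountable type nat -> bool. It is determined *)
(* up to order isomorphism by omega1_well_founded, omega1_countable and *)
(* omega1_uncountable below. *)
Definition cantor_wo : rel (nat -> bool) :=
  sval (well_ordering_principle (nat -> bool)).

Lemma cantor_woP : well_order cantor_wo.
Proof. exact: svalP (well_ordering_principle (nat -> bool)). Qed.

Definition omega1_base :=
  {x : nat -> bool | `[< countable [set y | cantor_wo y x] >]}.

HB.instance Definition _ := Choice.on omega1_base.

Definition omega1_le : rel omega1_base := fun x y => cantor_wo (sval x) (sval y).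

Lemma cantor_wo_nonempty (A : set (nat -> bool)) : A !=set0 ->
  exists2 x, A x & forall y, A y -> cantor_wo x y.
Proof.
move=> [a Aa].
have [|z [[Az zmin] _]] := cantor_woP (A := fun x => `[< A x >]).
  by exists a; apply/asboolP.
by exists z; [exact/asboolP|move=> y Ay; apply: zmin; apply/asboolP].
Qed.

Lemma cantor_wo_total : total cantor_wo.
Proof.
move=> x y; have [|z []->] := @cantor_wo_nonempty [set x; y].
- by exists x; left.
- by move=> h; rewrite h //; right.
- by move=> h; rewrite (h x) ?orbT//; left.
Qed.

Lemma cantor_wo_anti : antisymmetric cantor_wo.
Proof.
move=> x y; apply: (@wo_chain_antisymmetric _ cantor_wo predT) => //.
by move=> A _; exact: cantor_woP.
Qed.

Lemma cantor_wo_trans : transitive cantor_wo.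
Proof.
move=> y x z xy yz; have [|w wxyz wmin] := @cantor_wo_nonempty [set x; y; z].
  by exists x; left; left.
case: wxyz wmin => [[]|] -> wmin.
- by apply: wmin; right.
- have yx : cantor_wo y x by apply: wmin; left; left.
  by rewrite (@cantor_wo_anti x y)// xy.
- have zy : cantor_wo z y by apply: wmin; left; right.
  by rewrite -(@cantor_wo_anti y z)// yz.
Qed.

Lemma omega1_le_anti : antisymmetric omega1_le.
Proof. by move=> x y /cantor_wo_anti; exact: val_inj. Qed.
Lemma omega1_le_trans : transitive omega1_le.
Proof. by move=> y x z; exact: cantor_wo_trans. Qed.
Lemma omega1_le_total : total omega1_le.
Proof. by move=> x y; exact: cantor_wo_total. Qed.

Fact omega1_display : Order.disp_t. Proof. exact: Order.Disp tt tt. Qed.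

HB.instance Definition _ := @Order.isOrder.Build omega1_display omega1_base
  omega1_le _ _ _ (fun _ _ => erefl) (fun _ _ => erefl) (fun _ _ => erefl)
  omega1_le_anti omega1_le_trans omega1_le_total.

Definition omega1 := order_topology omega1_base.
HB.instance Definition _ := OrderTopological.on omega1.

Lemma omega1_well_founded (A : set omega1) : A !=set0 ->
  exists2 x, A x & forall y, A y -> (x <= y)%O.
Proof.
move=> [a Aa]; have [|x [b Ab <-] xmin] :=
  @cantor_wo_nonempty ((fun x : omega1 => sval x) @` A).
  by exists (sval a); exists a.
by exists b => // y Ay; apply: xmin; exists y.
Qed.

Lemma omega1_countable (x : omega1) : countable [set y : omega1 | (y <= x)%O].
Proof.
have /asboolP cx := svalP (x : omega1_base).
pose f (y : omega1) : nat -> bool := sval (y : omega1_base).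
have finj : {in [set y : omega1 | (y <= x)%O] &, injective f}.
  by move=> y z _ _; exact: val_inj.
rewrite -(eq_countable (inj_card_eq finj)); apply: sub_countable cx.
by apply: subset_card_le => _ [y yx <-].
Qed.

Lemma uncountable_cantor : ~ countable [set: nat -> bool].
Proof.
move=> /countable_injP[f finj].
pose d n := `[< forall h : nat -> bool, f h = n -> h n = false >].
have dE h : f h = f d -> h = d by move=> /finj; apply; rewrite inE.
have [dd|/negP dd] := boolP (d (f d)).
  by move/asboolP: (dd) => /(_ d erefl); rewrite dd.
apply: (dd); apply/asboolP => h /dE ->; exact/negbTE/negP.
Qed.

Lemma omega1_uncountable : ~ countable [set: omega1].
Proof.
pose f (y : omega1) : nat -> bool := sval (y : omega1_base).
have finj : {in [set: omega1] &, injective f} by move=> y z _ _; exact: val_inj.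
rewrite -(eq_countable (inj_card_eq finj)) => cW.
pose A := [set x : nat -> bool | ~ countable [set y | cantor_wo y x]].
have [A0|/set0P] := eqVneq A set0.
  apply: uncountable_cantor; apply: sub_countable cW; apply: subset_card_le.
  move=> x _; have cx : `[< countable [set y | cantor_wo y x] >].
    by apply: contra_notT (_ : ~ A x) => [/asboolPn //|]; rewrite A0.
  by exists (exist _ x cx).
move=> /cantor_wo_nonempty[x Ax xmin]; apply: Ax.
apply: sub_countable (_ : countable ((f @` setT) `|` [set x])); last first.
  by rewrite -bigcup2E; apply: bigcup_countable => // -[|[|i]] _ //=.
apply: subset_card_le => y /= yx.
have [->|yNx] := eqVneq y x; [by right|left].
have cy : `[< countable [set z | cantor_wo z y] >].
  apply: contraT => /asboolPn /xmin xy.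
  by rewrite (@cantor_wo_anti x y) ?eqxx// ?xy in yNx.
by exists (exist _ y cy).
Qed.

Lemma real_supremums (R : realType) (A : set R) M : A !=set0 ->
  (forall x, A x -> 0 <= x) -> (forall x, A x -> x <= M) -> supremums A !=set0.
Proof.
move=> A0 _ AM; exists (sup A); split.
  by apply: sup_upper_bound; split => //; exists M.
by move=> z zA; exact: sup_le_ub.
Qed.

Lemma complex_supremums (R : realType) (A : set R[i]) M : A !=set0 ->
  (forall x, A x -> 0 <= x) -> (forall x, A x -> x <= M) -> supremums A !=set0.
Proof.
move=> A0 Age0 AM; have ImA x : A x -> complex.Im x = 0 by move=> /Age0/ger0_Im.
pose B : set R := [set complex.Re x | x in A].
have B0 : B !=set0 by case: A0 => x Ax; exists (complex.Re x), x.
have BM : ubound B (complex.Re M).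
  by move=> _ [x /AM + <-]; rewrite lecE => /andP[].
exists (sup B)%:C%C; split.
  move=> x Ax; rewrite lecE /= ImA// eqxx /=.
  by apply: sup_upper_bound; [split => //; exists (complex.Re M)|exists x].
move=> z zA; rewrite lecE /=; apply/andP; split.
  by case: A0 => x /[dup] /zA; rewrite lecE => /andP[/eqP ->] _ /ImA ->.
by apply: sup_le_ub => // _ [x /zA + <-]; rewrite lecE => /andP[].
Qed.

Lemma omega1_nonempty : [set: omega1] !=set0.
Proof.
by apply/set0P/eqP => T0; apply: omega1_uncountable; rewrite T0; exact: countable0.
Qed.

Variant scalar_kind := RealScalars | ComplexScalars.

Definition scalars (R : realType) (k : scalar_kind) : numFieldType :=
  match k with RealScalars => R | ComplexScalars => R[i] end.

(* Norms of normedModType K live in K, hence suprema and infima of sets of *)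
(* nonnegative elements are taken in K itself. For K = R[i] the order of K is *)
(* partial (x <= y iff Im x = Im y and Re x <= Re y), but such bounds exist. *)
Section scalars_supremum.
Variables (R : realType) (k : scalar_kind).
Local Notation K := (scalars R k).
Implicit Type A : set K.

Lemma scalars_supremums A M : A !=set0 -> (forall x, A x -> 0 <= x) ->
  (forall x, A x -> x <= M) -> supremums A !=set0.
Proof. by case: k A M; [exact: real_supremums|exact: complex_supremums]. Qed.

Lemma scalars_infimums A : A !=set0 -> (forall x, A x -> 0 <= x) ->
  infimums A !=set0.
Proof.
move=> A0 Age0; have [a Aa] := A0.
pose B : set K := [set x | 0 <= x /\ lbound A x].
have [|||b [bub blb]] := @scalars_supremums B a.
- by exists 0; split.
- by move=> x [].
- by move=> x [_ /(_ _ Aa)].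
have b0 : 0 <= b by apply: bub.
exists b; split; first by move=> x Ax; apply: blb => y [_]; exact.
move=> y ylb; have /orP[y0|y0] : (0 <= y) || (y <= 0).
- have := ler_real (ylb _ Aa); rewrite (ger0_real (Age0 _ Aa)) => yr.
  by rewrite -realE yr.
- by apply: bub.
- exact: le_trans b0.
Qed.

Lemma supremum_ubound A M x : (forall x, A x -> 0 <= x) ->
  (forall x, A x -> x <= M) -> A x -> x <= supremum 0 A.
Proof.
move=> Age0 AM Ax; have A0 : A !=set0 by exists x.
rewrite /supremum ifF; last exact/negbTE/set0P.
by have /(xgetPex 0)[+ _] := scalars_supremums A0 Age0 AM; apply.
Qed.

Lemma supremum_le A M : A !=set0 -> (forall x, A x -> 0 <= x) ->
  (forall x, A x -> x <= M) -> supremum 0 A <= M.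
Proof.
move=> A0 Age0 AM; rewrite /supremum ifF; last exact/negbTE/set0P.
have /(xgetPex 0)[_ +] := scalars_supremums A0 Age0 AM.
exact.
Qed.

Lemma infimum_lbound A x : (forall x, A x -> 0 <= x) -> A x -> infimum 0 A <= x.
Proof.
move=> Age0 Ax; have A0 : A !=set0 by exists x.
rewrite /infimum ifF; last exact/negbTE/set0P.
by have /(xgetPex 0)[+ _] := scalars_infimums A0 Age0; apply.
Qed.

Lemma le_infimum A M : A !=set0 -> (forall x, A x -> 0 <= x) ->
  (forall x, A x -> M <= x) -> M <= infimum 0 A.
Proof.
move=> A0 Age0 AM; rewrite /infimum ifF; last exact/negbTE/set0P.
by have /(xgetPex 0)[_] := scalars_infimums A0 Age0; apply.
Qed.

End scalars_supremum.

Definition isomorphic (K : numFieldType) (U V : normedModType K) : Prop :=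
  exists (f : {linear U -> V}) (g : V -> U),
    [/\ cancel f g, cancel g f, continuous f & continuous g].

(* Finite direct sums carry the maximum norm, taken in the totally ordered *)
(* type of nonnegative elements of K, as for the matrix norm mx_norm. *)
Section direct_sum.
Variables (K : numFieldType) (I : finType) (E : normedModType K).
Implicit Types x y : {ffun I -> E}.

Definition ffun_norm x : K := (\big[Order.max/0%:nng]_i `|x i|%:nng)%:num.

Lemma ffun_norm_ge x i : `|x i| <= ffun_norm x.
Proof. by rewrite /ffun_norm -[leLHS]nngE num_le; exact: le_bigmax. Qed.

Lemma ffun_norm_le x (M : K) : 0 <= M -> (forall i, `|x i| <= M) ->
  ffun_norm x <= M.
Proof.
move=> M0 xM; rewrite /ffun_norm -[leRHS]/((NngNum M0)%:num) num_le.
by apply/bigmax_leP; split=> [|i _]; rewrite -num_le /=.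
Qed.

Lemma ffun_norm_ge0 x : 0 <= ffun_norm x.
Proof. by rewrite /ffun_norm. Qed.

Lemma ler_ffun_normD x y : ffun_norm (x + y) <= ffun_norm x + ffun_norm y.
Proof.
apply: ffun_norm_le => [|i]; first by rewrite addr_ge0 ?ffun_norm_ge0.
by rewrite ffunE (le_trans (ler_normD _ _))// lerD// ffun_norm_ge.
Qed.

Lemma ffun_normZ_le (a : K) x : ffun_norm (a *: x) <= `|a| * ffun_norm x.
Proof.
apply: ffun_norm_le => [|i]; first by rewrite mulr_ge0 ?ffun_norm_ge0.
by rewrite ffunE normrZ ler_wpM2l// ffun_norm_ge.
Qed.

Lemma ffun_normZ (a : K) x : ffun_norm (a *: x) = `|a| * ffun_norm x.
Proof.
apply/le_anti; rewrite ffun_normZ_le /=.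
have [->|a0] := eqVneq a 0; first by rewrite normr0 mul0r ffun_norm_ge0.
rewrite -[in leLHS](scalerK a0 x) -ler_pdivlMl ?normr_gt0// -normfV.
exact: ffun_normZ_le.
Qed.

Lemma ffun_norm0_eq0 x : ffun_norm x = 0 -> x = 0.
Proof.
move=> x0; apply/ffunP => i; rewrite ffunE; apply/eqP.
by rewrite -normr_le0 -x0 ffun_norm_ge.
Qed.

HB.instance Definition _ := @Lmodule_isNormed.Build K {ffun I -> E}
  ffun_norm ler_ffun_normD ffun_normZ ffun_norm0_eq0.

End direct_sum.

Section closed_subspace.
Variables (K : numFieldType) (E : normedModType K).

Record closed_subspace := ClosedSubspace {
  closed_subspace_pred :> {pred E};
  closed_subspace_submod : submod_closed closed_subspace_pred;
  closed_subspaceP : closed [set x | x \in closed_subspace_pred] }.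

HB.instance Definition _ (S : closed_subspace) :=
  GRing.isSubmodClosed.Build K E (closed_subspace_pred S)
    (closed_subspace_submod S).
HB.instance Definition _ (S : closed_subspace) :=
  GRing.isZmodClosed.Build E (closed_subspace_pred S)
    (GRing.submod_closedB (closed_subspace_submod S)).

Definition subspace_type (S : closed_subspace) := {x : E | x \in S}.

Variable S : closed_subspace.
Local Notation sE := (subspace_type S).

HB.instance Definition _ := SubChoice.on sE.
HB.instance Definition _ := [SubChoice_isSubLmodule of sE by <:].

Definition subspace_norm (x : sE) : K := `|val x|.

Lemma ler_subspace_normD (x y : sE) :
  subspace_norm (x + y) <= subspace_norm x + subspace_norm y.
Proof. exact: ler_normD. Qed.

Lemma subspace_normZ (a : K) (x : sE) :
  subspace_norm (a *: x) = `|a| * subspace_norm x.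
Proof. exact: normrZ. Qed.

Lemma subspace_norm0_eq0 (x : sE) : subspace_norm x = 0 -> x = 0.
Proof. by move=> /normr0_eq0 x0; exact: val_inj. Qed.

HB.instance Definition _ := @Lmodule_isNormed.Build K sE
  subspace_norm ler_subspace_normD subspace_normZ subspace_norm0_eq0.

End closed_subspace.

Section quotient_space.
Variables (R : realType) (k : scalar_kind).
Local Notation K := (scalars R k).
Local Open Scope quotient_scope.

Definition quotient_type (E : normedModType K) (S : closed_subspace E) :=
  Quotient.quot (closed_subspace_pred S).

Variables (E : normedModType K) (S : closed_subspace E).
Local Notation Q := (quotient_type S).
Implicit Types (p q : Q) (a : K) (x y : E).

HB.instance Definition _ := GRing.Zmodule.on Q.
HB.instance Definition _ := Quotient.on Q.

Lemma quotient_eqP x y : (x - y \in S) <-> \pi_Q x = \pi_Q y.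
Proof.
by rewrite Quotient.idealrBE; split=> /eqP.
Qed.

Lemma quotient_piD x y : \pi_Q (x + y) = \pi_Q x + \pi_Q y.
Proof. exact: Quotient.pi_add. Qed.

Definition quotient_scale a q : Q := \pi_Q (a *: repr q).

Lemma quotient_scale_pi a x : quotient_scale a (\pi_Q x) = \pi_Q (a *: x).
Proof.
apply/quotient_eqP; rewrite -scalerBr; apply: rpredZ.
by apply/quotient_eqP; rewrite reprK.
Qed.

Lemma quotient_scalerA a b q :
  quotient_scale a (quotient_scale b q) = quotient_scale (a * b) q.
Proof. by rewrite -[q]reprK (quotient_scale_pi b) !quotient_scale_pi scalerA. Qed.

Lemma quotient_scale1r : left_id 1 quotient_scale.
Proof. by move=> q; rewrite -[q]reprK quotient_scale_pi scale1r. Qed.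

Lemma quotient_scalerDr : right_distributive quotient_scale +%R.
Proof.
move=> a p q; rewrite -[p]reprK -[q]reprK -quotient_piD !quotient_scale_pi.
by rewrite scalerDr quotient_piD.
Qed.

Lemma quotient_scalerDl q : {morph quotient_scale^~ q : a b / a + b}.
Proof.
by move=> a b; rewrite -[q]reprK !quotient_scale_pi scalerDl quotient_piD.
Qed.

HB.instance Definition _ := GRing.Zmodule_isLmodule.Build K Q
  quotient_scalerA quotient_scale1r quotient_scalerDr quotient_scalerDl.

(* The usual quotient norm, the distance from 0 to the coset q. *)
Definition quotient_norm q : K :=
  infimum 0 [set `|x| | x in [set x | \pi_Q x = q]].

Let norms_neq0 q : [set `|x| | x in [set x | \pi_Q x = q]] !=set0.
Proof. by exists `|repr q|, (repr q) => //=; rewrite reprK. Qed.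

Let norms_ge0 q (r : K) : [set `|x| | x in [set x | \pi_Q x = q]] r -> 0 <= r.
Proof. by move=> [x _ <-]. Qed.

Lemma quotient_norm_le x : quotient_norm (\pi_Q x) <= `|x|.
Proof. by apply: infimum_lbound; [exact: norms_ge0|exists x]. Qed.

Lemma le_quotient_norm q (M : K) : (forall x, \pi_Q x = q -> M <= `|x|) ->
  M <= quotient_norm q.
Proof.
move=> Mq; apply: le_infimum; [exact: norms_neq0|exact: norms_ge0|].
by move=> _ [x /Mq + <-].
Qed.

Lemma quotient_norm_ge0 q : 0 <= quotient_norm q.
Proof. exact: le_quotient_norm. Qed.

Lemma ler_quotient_normD p q :
  quotient_norm (p + q) <= quotient_norm p + quotient_norm q.
Proof.
rewrite -lerBlDr; apply: le_quotient_norm => x xp.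
rewrite lerBlDr -lerBlDl; apply: le_quotient_norm => y yq.
rewrite lerBlDl -xp -yq -quotient_piD.
exact: le_trans (quotient_norm_le _) (ler_normD _ _).
Qed.

Lemma quotient_normZ_le a q : quotient_norm (a *: q) <= `|a| * quotient_norm q.
Proof.
have [->|a0] := eqVneq a 0.
  rewrite scale0r normr0 mul0r -[leRHS](@normr0 _ E).
  suff -> : 0 = \pi_Q 0 by exact: quotient_norm_le.
  by rewrite -[in RHS](subrr 0) raddfB subrr.
rewrite -ler_pdivrMl ?normr_gt0//; apply: le_quotient_norm => x xq.
rewrite ler_pdivrMl ?normr_gt0// -normrZ -xq.
by rewrite [_ *: _]quotient_scale_pi quotient_norm_le.
Qed.

Lemma quotient_normZ a q : quotient_norm (a *: q) = `|a| * quotient_norm q.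
Proof.
apply/le_anti; rewrite quotient_normZ_le /=.
have [->|a0] := eqVneq a 0; first by rewrite normr0 mul0r quotient_norm_ge0.
rewrite -[in leLHS](scalerK a0 q) -ler_pdivlMl ?normr_gt0// -normfV.
exact: quotient_normZ_le.
Qed.

Lemma quotient_norm0_eq0 q : quotient_norm q = 0 -> q = 0.
Proof.
rewrite -[q]reprK; set x := repr q => q0.
suff xS : x \in S.
  have -> : 0 = \pi_Q 0 by rewrite -[in RHS](subrr 0) raddfB subrr.
  by apply/quotient_eqP; rewrite subr0.
apply: (@closed_subspaceP _ _ S) => U /nbhs_ballP[e /= e0 eU].
have [[y [yq ye]]|noy] := pselect (exists y, \pi_Q y = \pi_Q x /\ `|y| < e).
  exists (x - y); split; first by apply/quotient_eqP.
  by apply: eU; rewrite -ball_normE /= opprB addrC subrK.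
have : e <= 0.
  rewrite -[leRHS]q0; apply: le_quotient_norm => y yq.
  rewrite real_leNgt ?normr_real ?gtr0_real//.
  by apply/negP => ye; apply: noy; exists y.
by move=> /(lt_le_trans e0); rewrite ltxx.
Qed.

HB.instance Definition _ := @Lmodule_isNormed.Build K Q
  quotient_norm ler_quotient_normD quotient_normZ quotient_norm0_eq0.

End quotient_space.

Section C0_omega1.
Variables (R : realType) (k : scalar_kind).
Local Notation K := (scalars R k).

Definition C0_omega1_pred : {pred omega1 -> K} := fun f =>
  `[< continuous f /\
      exists a : omega1, forall x : omega1, (a <= x)%O -> f x = 0 >].

Definition C0_omega1 := {f : omega1 -> K | f \in C0_omega1_pred}.

Lemma C0_omega1_submod : submod_closed C0_omega1_pred.
Proof.
split.
  have [x0 _] := omega1_nonempty.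
  by apply/asboolP; split; [exact: cst_continuous|exists x0].
move=> a f g /asboolP[fc [b fb]] /asboolP[gc [c gc0]]; apply/asboolP; split.
  move=> x; apply: (@continuousD _ K); last exact: gc.
  by apply: (@continuousZr _ K); exact: fc.
exists (Order.max b c) => x; rewrite ge_max => /andP[bx cx].
by rewrite -[LHS]/(a *: f x + g x) fb// gc0// scaler0 addr0.
Qed.

HB.instance Definition _ := SubChoice.on C0_omega1.
HB.instance Definition _ := GRing.SubChoice_isSubLmodule.Build K (omega1 -> K) _
  C0_omega1 C0_omega1_submod.

Implicit Types f g : C0_omega1.

Lemma C0_omega1_bounded f : exists M : K, forall x, `|val f x| <= M.
Proof.
have /asboolP[fc [a fa]] := valP f.
pose P x := exists M : K, forall y, (y <= x)%O -> `|val f y| <= M.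
suff /(_ a)[M fM] : forall x, P x.
  exists M => x; have [|/ltW/fa ->] := leP x a; first exact: fM.
  by rewrite normr0; apply: le_trans (fM a _).
move=> x; apply: contrapT => nPx.
have [|{nPx}z nPz zmin] := @omega1_well_founded [set x | ~ P x]; first by exists x.
apply: nPz.
have /cvgrPdist_lt/(_ 1 ltr01) fz := fc z.
have {fz} : nbhs z [set y | `|val f z - val f y| < 1] by exact: fz.
rewrite (@itv_nbhsE _ omega1 z) => -[i [io zi] fi].
have fM y : y \in i -> `|val f y| <= `|val f z| + 1.
  move=> /fi /= /ltW yz; rewrite -lerBlDl (le_trans (lerB_dist _ _))//.
  by rewrite distrC.
case: i io zi {fi} fM => [[[] l|[]] r] //= io zi fM.
- have [M lM] : P l.
    apply: contrapT => /zmin; rewrite leNgt.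
    by move: zi; rewrite in_itv /= => /andP[->].
  exists (M + (`|val f z| + 1)) => y yz.
  have M0 : 0 <= M by apply: le_trans (lM l _).
  have [yl|ly] := leP y l; first by rewrite ler_wpDr ?lM// addr_ge0.
  rewrite ler_wpDl// fM// in_itv /= ly /=.
  move: zi; rewrite in_itv /= => /andP[_]; case: r {io fM} => [[] r|//].
    exact: le_lt_trans.
  exact: le_trans.
exists (`|val f z| + 1) => y yz; apply: fM.
move: zi; rewrite !in_itv /=; case: r {io} => [[] r|[]//].
  exact: le_lt_trans.
exact: le_trans.
Qed.

(* supremum 0 A is the least upper bound of A; the bound exists by *)
(* C0_omega1_bounded, so the default value 0 is never used. *)
Definition C0_norm f : K := supremum 0 [set `|val f x| | x in [set: omega1]].

Let norms_neq0 f : [set `|val f x| | x in [set: omega1]] !=set0.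
Proof. by have [x _] := omega1_nonempty; exists `|val f x|, x. Qed.

Let norms_ge0 f (r : K) : [set `|val f x| | x in [set: omega1]] r -> 0 <= r.
Proof. by move=> [x _ <-]. Qed.

Lemma C0_norm_ge f x : `|val f x| <= C0_norm f.
Proof.
have [M fM] := C0_omega1_bounded f.
apply: (@supremum_ubound _ _ _ M); [exact: norms_ge0| |by exists x].
by move=> _ [y _ <-].
Qed.

Lemma C0_norm_le f (M : K) : (forall x, `|val f x| <= M) -> C0_norm f <= M.
Proof.
move=> fM; apply: supremum_le; [exact: norms_neq0|exact: norms_ge0|].
by move=> _ [y _ <-].
Qed.

Lemma ler_C0_normD f g : C0_norm (f + g) <= C0_norm f + C0_norm g.
Proof.
apply: C0_norm_le => x; rewrite (le_trans (ler_normD _ _))//.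
by rewrite lerD// C0_norm_ge.
Qed.

Lemma C0_normZ_le (a : K) f : C0_norm (a *: f) <= `|a| * C0_norm f.
Proof.
apply: C0_norm_le => x; rewrite [X in `|X|](_ : _ = a * val f x)//.
by rewrite normrM ler_wpM2l// C0_norm_ge.
Qed.

Lemma C0_norm_ge0 f : 0 <= C0_norm f.
Proof.
by have [x _] := omega1_nonempty; exact: le_trans (C0_norm_ge f x).
Qed.

Lemma C0_normZ (a : K) f : C0_norm (a *: f) = `|a| * C0_norm f.
Proof.
apply/le_anti; rewrite C0_normZ_le /=.
have [->|a0] := eqVneq a 0; first by rewrite normr0 mul0r C0_norm_ge0.
rewrite -[in leLHS](scalerK a0 f) -ler_pdivlMl ?normr_gt0// -normfV.
exact: C0_normZ_le.
Qed.

Lemma C0_norm0_eq0 f : C0_norm f = 0 -> f = 0.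
Proof.
move=> f0; apply: val_inj; apply/funext => x; apply/eqP.
by rewrite -normr_le0 -f0 C0_norm_ge.
Qed.

HB.instance Definition _ := @Lmodule_isNormed.Build K C0_omega1
  C0_norm ler_C0_normD C0_normZ C0_norm0_eq0.

End C0_omega1.

Definition C0_omega1_sum (R : realType) (k : scalar_kind) (n : nat) :
  normedModType (scalars R k) := {ffun 'I_n -> C0_omega1 R k}.

(* Main.v *)
Require Import Defs.
From HB Require Import structures.
From mathcomp Require Import all_boot all_order all_algebra.
From mathcomp.real_closed Require Import complex.
From mathcomp Require Import all_classical all_reals all_analysis.
Set Implicit Arguments.
Unset Strict Implicit.
Unset Printing Implicit Defensive.
Import Order.TTheory GRing.Theory Num.Theory.
Import numFieldNormedType.Exports.
Local Open Scope classical_set_scope.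
Local Open Scope ring_scope.

(* A bounded operator T on E = C_0[0, omega_1) has a scalar c such that, for all *)
(* late x, the value of T 1_[0, g] at x is c as soon as g is large: the limit in g *)
(* is a continuous function of x on [0, omega_1), hence eventually constant. An *)
(* operator between direct sums of copies of E thus has a scalar matrix, and when *)
(* its dimensions force a null vector one obtains, by composing with that vector, *)
(* finitely many operators S_j with scalar 0. *)
(* On the domain side (subspaces), an average over k < N of indicators of overlapping *)
(* intervals has norm 1, while its images under the S_j have norm O(1/N), *)
(* so the operator is not bounded below. On the codomain side (quotients), a *)
(* closing-off argument gives a single point al at which all functions in the *)
(* range of the S_j vanish, so the operator is not surjective. *)

(** The count of copies is detected by linear algebra. The scalars of [tail_scalar_exists] depend
    linearly on the operator ([tail_scalar_comb]), so an operator between sums of m and n copies has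
    a scalar matrix. If n < m, this matrix, with m rows and n columns, has a nonzero left null
    vector ([exists_left_null]). Two locality properties, both due to countability of initial
    segments, make operators with scalar 0 degenerate. Up to x, the image of f ignores changes of f
    beyond some g ([op_tail]). All functions supported in [0, g] have images supported in one
    initial segment ([op_head]). They yield [tail_zero_not_bounded_below] and
    [tail_zero_common_zero], hence [bounded_below_leq] for embeddings and [surjective_leq] for
    quotients. *)

(** Otherwise the countable initial segments below the points [s a] would cover omega_1. *)
Lemma omega1_countable_ubound (T : Type) (A : set T) (s : T -> omega1) :
  countable A -> exists b : omega1, forall a, A a -> (s a <= b)%O.
Proof.
move=> cA; apply: contrapT => nb; apply: omega1_uncountable.
apply: (@sub_countable _ _ _ (\bigcup_(a in A) [set y | (y <= s a)%O])).
  apply: subset_card_le => b _; apply: contrapT => bA; apply: nb; exists b => a Aa.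
  by case: leP => // /ltW bs; exfalso; apply: bA; exists a.
by apply: bigcup_countable => // a _; exact: omega1_countable.
Qed.

Lemma omega1_unbounded (x : omega1) : exists y : omega1, (x < y)%O.
Proof.
apply: contrapT => nx; apply: omega1_uncountable.
apply: sub_countable (omega1_countable x); apply: subset_card_le => y _ /=.
by case: leP => // xy; case: nx; exists y.
Qed.

Lemma omega1_ubound2 (x y : omega1) : exists z : omega1, (x <= z)%O /\ (y < z)%O.
Proof.
have [z] := omega1_unbounded (Order.max x y).
by rewrite gt_max => /andP[/ltW xz yz]; exists z.
Qed.

Lemma omega1_seq_lub (s : nat -> omega1) : exists z : omega1,
  (forall n, (s n <= z)%O) /\ forall l, (l < z)%O -> exists n, (l < s n)%O.
Proof.
have [b sb] := @omega1_countable_ubound nat setT s (countableP _).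
have [|z zs zmin] := @omega1_well_founded [set z | forall n, (s n <= z)%O].
  by exists b => n; exact: sb.
exists z; split=> // l lz; apply: contrapT => ls.
suff : (z <= l)%O by rewrite leNgt lz.
by apply: zmin => n; case: leP => // ?; case: ls; exists n.
Qed.

(** * Continuous scalar functions on omega_1 and their truncations *)

Section scalar_functions.
Variable K : numFieldType.
Implicit Type u : omega1 -> K.

(** The first alternative comes from a basic interval unbounded below; it is the only one possible
    when z is the least point. *)
Lemma continuous_left_nbhs u (z : omega1) (e : K) : continuous u -> 0 < e ->
  (forall y, (y <= z)%O -> `|u z - u y| < e) \/
  (exists2 l, (l < z)%O & forall y, (l < y <= z)%O -> `|u z - u y| < e).
Proof.
move=> uc e0.
have /cvgrPdist_lt/(_ e e0) uz := uc z.
have {uz} : nbhs z [set y | `|u z - u y| < e] by exact: uz.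
rewrite (@itv_nbhsE _ omega1 z) => -[i [io zi] ui].
have {}ui y : y \in i -> `|u z - u y| < e by move=> /ui.
case: i io zi ui => [[[] l|[]] r] //= io zi ui; [right|left].
  exists l => [|y /andP[ly yz]].
    by move: zi; rewrite in_itv /= => /andP[].
  apply: ui; move: zi; rewrite !in_itv /= ly => /andP[_] /=.
  by case: r {io} => [[] r|[]//] /=; [exact: le_lt_trans|exact: le_trans].
move=> y yz; apply: ui; move: zi; rewrite !in_itv /=.
by case: r {io} => [[] r|[]//] /=; [exact: le_lt_trans|exact: le_trans].
Qed.

Lemma continuous_seq_lub u (s : nat -> omega1) (z : omega1) (e : K) :
    continuous u -> 0 < e -> (forall l, (l < z)%O -> exists n, (l < s n)%O) ->
  exists n, forall y, (s n <= y <= z)%O -> `|u z - u y| < e.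
Proof.
move=> uc e0 sz; have [uz|[l lz uz]] := continuous_left_nbhs z uc e0.
  by exists 0%N => y /andP[_]; exact: uz.
have [n ln] := sz _ lz; exists n => y /andP[ny yz].
by apply: uz; rewrite yz (lt_le_trans ln).
Qed.

Lemma continuous_seq_lub0 u (s : nat -> omega1) (z : omega1) :
    continuous u -> (forall n, (s n <= z)%O) ->
    (forall l, (l < z)%O -> exists n, (l < s n)%O) ->
  (forall n, u (s n) = 0) -> u z = 0.
Proof.
move=> uc sz zs us; apply/eqP; rewrite -normr_le0 real_leNgt//.
apply/negP => uz0; have [n /(_ (s n))] := continuous_seq_lub uc uz0 zs.
by rewrite lexx sz us subr0 ltxx => /(_ isT).
Qed.

Definition trunc_fun (g : omega1) u : omega1 -> K :=
  fun x => if (x <= g)%O then u x else 0.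

Lemma continuous_eq_open u v (A : set omega1) x : open A -> A x ->
  (forall y, A y -> u y = v y) -> {for x, continuous v} -> {for x, continuous u}.
Proof.
move=> oA Ax uv vx S; rewrite /= (uv x Ax) => /vx vS.
have Ax' : nbhs x A by apply: open_nbhs_nbhs.
by apply: filterS (filterI Ax' vS) => y [/uv + ?]; rewrite /preimage/= => ->.
Qed.

Lemma omega1_initial_open (g : omega1) : open [set x : omega1 | (x <= g)%O].
Proof.
(* [h] is the successor of [g], so the closed initial segment up to [g] is the open ray below
   [h]. *)
have [|h gh hmin] := @omega1_well_founded [set h | (g < h)%O].
  exact: omega1_unbounded.
suff -> : [set x : omega1 | (x <= g)%O] = `]-oo, h[%classic by exact: lray_open.
apply/seteqP; split=> x /=; rewrite in_itv /=; first by move/le_lt_trans; exact.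
by move=> xh; case: leP => // /hmin; rewrite leNgt xh.
Qed.

(** [0, g] is both open and closed, so cutting at [g] creates no jump. *)
Lemma trunc_fun_continuous g u : continuous u -> continuous (trunc_fun g u).
Proof.
move=> uc x; have [xg|gx] := leP x g.
  apply: (continuous_eq_open (omega1_initial_open g) xg _ (uc x)) => y yg.
  by rewrite /trunc_fun yg.
apply: (@continuous_eq_open _ (fun=> 0) `]g, +oo[%classic).
- exact: rray_open.
- by rewrite /= in_itv /= gx.
- by move=> y; rewrite /= in_itv /= andbT /trunc_fun leNgt => ->.
- exact: cst_continuous.
Qed.

End scalar_functions.

(** * Archimedean bounds and eventual constancy *)

Section scalars_archimedean.
Variables (R : realType) (k : scalar_kind).
Local Notation K := (scalars R k).

Lemma scalars_natr_bound (C : K) : 0 <= C -> exists n : nat, C < n%:R.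
Proof.
case: k C => /= C C0; first by exists (Num.bound C); exact: archi_boundP.
(* A nonnegative complex scalar is real, so the real bound applies to its real part. *)
have ReC : 0 <= complex.Re C by move: C0; rewrite lecE => /andP[].
exists (Num.bound (complex.Re C)).
rewrite -(rmorph_nat (@real_complex R)) ltcE /= ger0_Im// eqxx/=.
exact: archi_boundP.
Qed.

Lemma scalars_eq0 (x C : K) : (forall n, `|x| <= n.+1%:R^-1 * C) -> x = 0.
Proof.
move=> xC; apply/eqP/negPn/negP => x0; have {x0} x0 : 0 < `|x| by rewrite normr_gt0.
have C0 : 0 < C.
  by have := lt_le_trans x0 (xC 0%N); rewrite invr1 mul1r.
have [n] := @scalars_natr_bound (C / `|x|) (divr_ge0 (ltW C0) (ltW x0)).
rewrite ltr_pdivrMr// => Cn; have := xC n.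
rewrite mulrC ler_pdivlMr ?ltr0n// => /le_lt_trans/(_ Cn).
by rewrite mulrC ltr_pM2r// ltr_nat ltnNge leqnSn.
Qed.

(** If u oscillated by at least e on every tail, iterating the choice of a bad point would give an
    increasing sequence with jumps of at least e, against continuity at its supremum. The tails
    found for e = 1/(n+1) have a common one, on which u is constant. *)
Lemma continuous_eventually_cst (u : omega1 -> K) : continuous u ->
  exists b, forall x, (b <= x)%O -> u x = u b.
Proof.
move=> uc.
have osc (e : K) : 0 < e ->
    exists b, forall x, (b <= x)%O -> `|u x - u b| < e.
  move=> e0; apply: contrapT => nb.
  have /choice[f fP] : forall b, exists x, (b <= x)%O /\ ~ `|u x - u b| < e.
    move=> b; apply: contrapT => bx; apply: nb; exists b => x xb.
    by apply: contrapT => xe; apply: bx; exists x.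
  have [x0 _] := omega1_nonempty.
  have [z [sz zs]] := omega1_seq_lub (fun n => iter n f x0).
  have e2 : 0 < e / 2 by rewrite divr_gt0.
  have [n nz] := continuous_seq_lub uc e2 zs.
  have [le_s] := fP (iter n f x0); apply.
  rewrite (splitr e) -(subrKA (u z)) addrC (le_lt_trans (ler_normD _ _))//.
  rewrite [`|u (f _) - _|]distrC ltrD// nz//; first by rewrite lexx sz.
  by rewrite le_s (sz n.+1).
have /choice[b bP] : forall n, exists b, forall x, (b <= x)%O ->
  `|u x - u b| < n.+1%:R^-1 by move=> n; apply: osc; rewrite invr_gt0 ltr0n.
have [c bc] := @omega1_countable_ubound _ setT b (countableP _).
exists c => x cx; apply/eqP; rewrite -subr_eq0; apply/eqP.
apply: (@scalars_eq0 _ 2) => n; have bnc := bc n I.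
rewrite mulr_natr mulr2n -(subrKA (u (b n))) (le_trans (ler_normD _ _))//.
by rewrite [`|_ - u c|]distrC lerD// ltW// bP// (le_trans bnc).
Qed.

End scalars_archimedean.

(** * Truncations and indicators as elements of C_0[0, omega_1) *)

Section truncation.
Variables (R : realType) (k : scalar_kind).
Local Notation K := (scalars R k).
Local Notation E := (C0_omega1 R k).
Implicit Types (f : E) (u : omega1 -> K) (g x : omega1).

Lemma C0_valD f1 f2 x : val (f1 + f2) x = val f1 x + val f2 x.
Proof. by []. Qed.

Lemma C0_valB f1 f2 x : val (f1 - f2) x = val f1 x - val f2 x.
Proof. by []. Qed.

Lemma C0_valZ (a : K) f x : val (a *: f) x = a * val f x.
Proof. by []. Qed.

Lemma C0_val_sum (I : Type) (r : seq I) (P : pred I) (F : I -> E) x :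
  val (\sum_(i <- r | P i) F i) x = \sum_(i <- r | P i) val (F i) x.
Proof. exact: (big_morph (fun f => val f x) (fun _ _ => C0_valD _ _ _)). Qed.

Lemma C0_continuous f : continuous (val f).
Proof. by have /asboolP[] := valP f. Qed.

Lemma C0_support f : exists a : omega1, forall x, (a <= x)%O -> val f x = 0.
Proof. by have /asboolP[] := valP f. Qed.

Lemma trunc_fun_C0 g u : continuous u -> trunc_fun g u \in @C0_omega1_pred R k.
Proof.
move=> uc; apply/asboolP; split; first exact: trunc_fun_continuous.
by have [h gh] := omega1_unbounded g; exists h => x hx;
  rewrite /trunc_fun leNgt (lt_le_trans gh hx).
Qed.

Definition trunc g f : E :=
  exist (fun u => u \in @C0_omega1_pred R k) _ (trunc_fun_C0 g (@C0_continuous f)).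

Lemma truncE g f x : val (trunc g f) x = if (x <= g)%O then val f x else 0.
Proof. by []. Qed.

Definition ind g : E :=
  exist (fun u => u \in @C0_omega1_pred R k) _ (trunc_fun_C0 g (@cst_continuous omega1 K 1)).

Lemma indE g x : val (ind g) x = (x <= g)%O%:R.
Proof. by rewrite /= /trunc_fun; case: ifP. Qed.

End truncation.

(** * Locality of bounded operators and the scalar of an operator *)

Section operators.
Variables (R : realType) (k : scalar_kind).
Local Notation K := (scalars R k).
Local Notation E := (C0_omega1 R k).
Implicit Types (f : E) (g x : omega1) (T : {linear E -> E}).

Lemma C0_val_le f x : `|val f x| <= `|f|.
Proof. exact: C0_norm_ge. Qed.

Lemma C0_le f (M : K) : (forall x, `|val f x| <= M) -> `|f| <= M.
Proof. exact: C0_norm_le. Qed.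

Lemma C0_eq f1 f2 : (forall x, val f1 x = val f2 x) -> f1 = f2.
Proof. by move=> ff; apply/val_inj/funext. Qed.

Lemma ind_norm_le g : `|ind R k g| <= 1.
Proof. by apply: C0_le => x; rewrite indE; case: leP; rewrite ?normr1 ?normr0. Qed.

Definition bounded_op (U V : normedModType K) (T : U -> V) :=
  exists2 C : K, 0 <= C & forall v, `|T v| <= C * `|v|.

(* If the claim failed up to a factor [1/(n+1)], functions with arbitrarily *)
(* late supports and [T f x = 1] could be added up with disjoint supports, *)
(* which makes [T f x] large while the norm stays below [n + 1]. *)
Lemma op_tail1 T x : bounded_op T -> exists g, forall f,
  (forall y, (y <= g)%O -> val f y = 0) -> val (T f) x = 0.
Proof.
move=> [C C0 TC].
have small n : exists g, forall f, (forall y, (y <= g)%O -> val f y = 0) ->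
    `|val (T f) x| <= n.+1%:R^-1 * `|f|.
  apply: contrapT => ng.
  have tail g : exists f, [/\ forall y, (y <= g)%O -> val f y = 0,
      val (T f) x = 1 & `|f| <= n.+1%:R].
    apply: contrapT => nf; apply: ng; exists g => f fg; apply: contrapT => Tf.
    have Tfx0 : val (T f) x != 0.
      by apply: contra_notN Tf => /eqP ->; rewrite normr0 mulr_ge0 ?invr_ge0.
    apply: nf; exists ((val (T f) x)^-1 *: f); split.
    - by move=> y yg; rewrite C0_valZ fg// mulr0.
    - by rewrite linearZ C0_valZ mulVf.
    - rewrite normrZ normfV mulrC ler_pdivrMr ?normr_gt0//.
      rewrite -ler_pdivrMl ?ltr0n//; apply: contraT => nle; case: Tf.
      rewrite real_leNgt ?normr_real ?realM ?realV ?realn//.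
      by apply: contra nle => /ltW.
  have sums N : exists f, val (T f) x = N%:R /\ `|f| <= n.+1%:R.
    elim: N => [|N [f [fN fn]]].
      by exists 0; rewrite linear0 normr0 ler0n.
    have [a fa] := C0_support f; have [h [ha hT hn]] := tail a.
    exists (f + h); split; first by rewrite linearD C0_valD fN hT natr1.
    apply: C0_le => y; rewrite C0_valD; have [ya|ay] := leP y a.
      by rewrite ha// addr0 (le_trans (C0_val_le _ _)).
    by rewrite fa ?(ltW ay)// add0r (le_trans (C0_val_le _ _)).
  have [N] := @scalars_natr_bound R k (C * n.+1%:R) (mulr_ge0 C0 (ler0n _ _)).
  have [f [fN fn]] := sums N.
  rewrite -[N%:R]ger0_norm ?ler0n// -fN => /lt_le_trans/(_ (C0_val_le _ _)).
  by move=> /lt_le_trans/(_ (TC _))/lt_le_trans/(_ (ler_wpM2l C0 fn)); rewrite ltxx.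
have /choice[s sP] := small.
have [g gs] := @omega1_countable_ubound _ setT s (countableP _).
exists g => f fg; apply: (@scalars_eq0 _ _ _ `|f|) => n.
by apply: sP => y ys; apply: fg; exact: le_trans ys (gs n I).
Qed.

(** Only countably many points y lie below x, so the thresholds of [op_tail1] have a common
    bound. *)
Lemma op_tail T x : bounded_op T -> exists g, forall f,
  (forall y, (y <= g)%O -> val f y = 0) -> forall y, (y <= x)%O -> val (T f) y = 0.
Proof.
move=> bT; have /choice[s sP] := fun y => op_tail1 y bT.
have [g gs] := omega1_countable_ubound s (omega1_countable x).
exists g => f fg y yx; apply: (sP y) => z zy; apply: fg.
exact: le_trans zy (gs _ _).
Qed.

(** Transfinite induction on the truncation point z: by continuity at z, the part of f just below z
    is uniformly close to a multiple of a difference of two indicators, which contributes nothing at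
    x. *)
Lemma op_head0 T x g : bounded_op T ->
    (forall b, (b <= g)%O -> val (T (ind R k b)) x = 0) ->
  forall f, (forall y, (g < y)%O -> val f y = 0) -> val (T f) x = 0.
Proof.
move=> [C C0 TC] Tind f fg.
have TC' h (e : K) : (forall y, `|val h y| <= e) -> `|val (T h) x| <= e * C.
  move=> he; rewrite mulrC (le_trans (C0_val_le _ _))// (le_trans (TC _))//.
  by rewrite ler_wpM2l// C0_le.
suff Tz : forall z, (z <= g)%O -> val (T (trunc z f)) x = 0.
  rewrite -(Tz g (lexx g)); congr (val (T _) x); apply: C0_eq => y.
  by rewrite truncE; case: leP => // /fg.
move=> z0 z0g; apply: contrapT => Tz0.
have [|z [zg Tz] zmin] :=
  @omega1_well_founded [set z | (z <= g)%O /\ val (T (trunc z f)) x <> 0].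
  by exists z0.
apply: Tz; apply: (@scalars_eq0 _ _ _ C) => n; set e := n.+1%:R^-1.
have e0 : 0 < e by rewrite invr_gt0 ltr0n.
have [fz|[l lz fz]] := continuous_left_nbhs z (@C0_continuous _ _ f) e0.
  pose h := trunc z f - val f z *: ind R k z.
  have -> : trunc z f = h + val f z *: ind R k z by rewrite subrK.
  rewrite linearD linearZ C0_valD C0_valZ Tind// mulr0 addr0; apply: TC' => y.
  rewrite C0_valB C0_valZ truncE indE; case: leP => [yz|_].
    by rewrite mulr1 distrC ltW// fz.
  by rewrite mulr0 subr0 normr0 ltW.
have Tl : val (T (trunc l f)) x = 0.
  apply: contrapT => Tl; have : (z <= l)%O.
    by apply: zmin; split=> //; rewrite (le_trans (ltW lz)).
  by rewrite leNgt lz.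
(* [h] lives on (l, z], where it equals f minus the constant f(z); hence its norm is at most [e]. *)
pose h := trunc z f - trunc l f - val f z *: (ind R k z - ind R k l).
have -> : trunc z f = h + val f z *: (ind R k z - ind R k l) + trunc l f.
  by rewrite !subrK.
have TD a p q r v : val (T (v + a *: (p - q) + r)) x =
    val (T v) x + a * (val (T p) x - val (T q) x) + val (T r) x.
  by rewrite linearD (linearD T v) linearZ linearB.
rewrite TD Tl !Tind//; last exact: le_trans (ltW lz) zg.
rewrite subr0 mulr0 !addr0; apply: TC' => y.
rewrite !C0_valB C0_valZ C0_valB !truncE !indE; case: (leP y l) => [yl|ly].
  by rewrite (le_trans yl (ltW lz)) !subrr mulr0 subr0 normr0 ltW.
rewrite !subr0; case: leP => [yz|_].
  by rewrite mulr1 distrC ltW// fz// ly.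
by rewrite mulr0 subr0 normr0 ltW.
Qed.

(** By [op_head0] it suffices to go beyond the supports of the images of the countably many
    indicators of [0, b] with b <= g. *)
Lemma op_head T g : bounded_op T -> exists s, forall f,
  (forall y, (g < y)%O -> val f y = 0) -> forall x, (s <= x)%O -> val (T f) x = 0.
Proof.
move=> bT; have /choice[a aP] := fun b => C0_support (T (ind R k b)).
have [s sa] := omega1_countable_ubound a (omega1_countable g).
exists s => f fg x sx; apply: (op_head0 bT _ fg) => b bg; apply: aP.
exact: le_trans (sa _ _) sx.
Qed.

(* [c] is the entry of [T**] at the point omega_1 *)
Definition tail_scalar T (c : K) := exists b, forall x, (b <= x)%O ->
  exists g0, forall g, (g0 <= g)%O -> val (T (ind R k g)) x = c.

Lemma op_ind_tail T x : bounded_op T -> exists g0, forall g y,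
  (g0 <= g)%O -> (y <= x)%O -> val (T (ind R k g)) y = val (T (ind R k g0)) y.
Proof.
move=> bT; have [g0 g0P] := op_tail x bT; exists g0 => g y g0g yx.
apply/eqP; rewrite -subr_eq0 -C0_valB -linearB g0P// => z zg0.
by rewrite C0_valB !indE zg0 (le_trans zg0 g0g) subrr.
Qed.

Lemma tail_scalar_exists T : bounded_op T -> exists c, tail_scalar T c.
Proof.
move=> bT; have /choice[a aP] := fun x => op_ind_tail x bT.
(* On the open set [0, x], [u] coincides with the image of one indicator, and is therefore
   continuous. *)
pose u x : K := val (T (ind R k (a x))) x.
have uc : continuous u.
  move=> x; have := @C0_continuous _ _ (T (ind R k (a x))) x.
  apply: (continuous_eq_open (omega1_initial_open x) (lexx x)) => y yx.
  have [m [xm ym]] := omega1_ubound2 (a x) (a y).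
  by rewrite -(aP x _ _ xm yx) (aP y _ _ (ltW ym) (lexx y)).
have [b bP] := continuous_eventually_cst uc.
exists (u b), b => x bx; exists (a x) => g ag.
by rewrite (aP x)// -(bP x bx).
Qed.

End operators.

(** * Finite families of operators with scalar 0 *)

Section tail_zero.
Variables (R : realType) (k : scalar_kind) (I : finType).
Local Notation K := (scalars R k).
Local Notation E := (C0_omega1 R k).
Implicit Types (f : E) (g x : omega1).
Variables (T : I -> {linear E -> E}) (bT : forall i, bounded_op (T i)).
Hypothesis T0 : forall i, tail_scalar (T i) 0.

Lemma finite_ubound (s : I -> omega1) : exists b, forall i, (s i <= b)%O.
Proof.
have [b sb] := @omega1_countable_ubound I setT s (countableP _).
by exists b => i; exact: sb.
Qed.

Lemma tail_zero_start : exists b, forall i x, (b <= x)%O ->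
  exists g0, forall g, (g0 <= g)%O -> val (T i (ind R k g)) x = 0.
Proof.
have /choice[s sP] := T0; have [b bs] := finite_ubound s.
by exists b => i x bx; apply: sP; exact: le_trans bx.
Qed.

Lemma family_tail x : exists g, forall i f,
  (forall y, (y <= g)%O -> val f y = 0) -> forall y, (y <= x)%O -> val (T i f) y = 0.
Proof.
have /choice[s sP] := fun i => op_tail x (bT i); have [g gs] := finite_ubound s.
exists g => i f fg; apply: sP => y ys; apply: fg; exact: le_trans ys (gs i).
Qed.

Lemma family_head g : exists s, forall i f,
  (forall y, (g < y)%O -> val f y = 0) -> forall x, (s <= x)%O -> val (T i f) x = 0.
Proof.
have /choice[s sP] := fun i => op_head g (bT i); have [h hs] := finite_ubound s.
by exists h => i f fg x hx; apply: sP fg _ _; exact: le_trans (hs i) hx.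
Qed.

(** Replacing [g] by a much later point does not change the image up to x, and for late indicators
    its value at y is 0. *)
Lemma tail_zero_ind x b g i y : (forall x, (b <= x)%O ->
    exists g0, forall g, (g0 <= g)%O -> val (T i (ind R k g)) x = 0) ->
  (forall f, (forall y, (y <= g)%O -> val f y = 0) ->
    forall y, (y <= x)%O -> val (T i f) y = 0) ->
  (b <= y <= x)%O -> val (T i (ind R k g)) y = 0.
Proof.
move=> bP gP /andP[by_ yx]; have [g0 g0P] := bP _ by_.
have [h [gh /ltW g0h]] := omega1_ubound2 g g0.
rewrite -(g0P h g0h); apply/esym/eqP; rewrite -subr_eq0 -C0_valB -linearB gP// => z zg.
by rewrite C0_valB !indE zg (le_trans zg gh) subrr.
Qed.

(* [al] is a limit of ordinals [s n] such that each [T i] maps functions *)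
(* supported up to [s n] to functions vanishing from [s n.+1] on, and functions *)
(* vanishing up to [s n.+1] to functions vanishing up to [s n]. So the functional *)
(* [f |-> T i f al] is a multiple of the evaluation at [al], and the multiple is *)
(* [0] by [T0]. *)
Lemma tail_zero_common_zero : exists al, forall i f, val (T i f) al = 0.
Proof.
have [b bP] := tail_zero_start.
have /choice[next nextP] : forall g, exists h, [/\ (g <= h)%O,
    forall i f, (forall y, (g < y)%O -> val f y = 0) ->
      forall x, (h <= x)%O -> val (T i f) x = 0 &
    forall i f, (forall y, (y <= h)%O -> val f y = 0) ->
      forall y, (y <= g)%O -> val (T i f) y = 0].
  move=> g; have [s sP] := family_head g; have [t tP] := family_tail g.
  have [h1 [sh1 /ltW th1]] := omega1_ubound2 s t.
  have [h [h1h /ltW gh]] := omega1_ubound2 h1 g; exists h; split=> //.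
    by move=> i f fg x hx; apply: (sP i f fg); rewrite (le_trans sh1)// (le_trans h1h).
  move=> i f fh; apply: tP => y yt; apply: fh.
  by rewrite (le_trans yt)// (le_trans th1).
pose s n := iter n next b.
have bs n : (b <= s n)%O.
  by elim: n => [//|n]; move/le_trans; apply; have [] := nextP (s n).
have [al [sal als]] := omega1_seq_lub s.
exists al => i f.
have lim0 h : (forall n, val (T i h) (s n) = 0) -> val (T i h) al = 0.
  by move=> hs; apply: (continuous_seq_lub0 (@C0_continuous _ _ _) sal als hs).
have late h : (forall y, (y <= al)%O -> val h y = 0) -> val (T i h) al = 0.
  move=> hal; apply: lim0 => n; have [_ _ /(_ i h)] := nextP (s n).
  by apply=> // y /le_trans /(_ (sal n.+1)); exact: hal.
have ind0 : val (T i (ind R k al)) al = 0.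
  apply: lim0 => n; have [_ _ nP] := nextP (s n).
  apply: (tail_zero_ind (bP i) (x := s n)); last by rewrite bs lexx.
  move=> h hal; apply: nP => y /le_trans /(_ (sal n.+1)); exact: hal.
(* [f] splits into a part beyond [al], a multiple of the indicator, and [h]. The first two
   contribute 0 at [al], and [h] is small just below [al]. *)
pose h := trunc al f - val f al *: ind R k al.
suff h0 : val (T i h) al = 0.
  have -> : f = (f - trunc al f) + (h + val f al *: ind R k al).
    by rewrite !subrK.
  rewrite linearD C0_valD late ?add0r; last first.
    by move=> y yal; rewrite C0_valB truncE yal subrr.
  by rewrite linearD linearZ C0_valD C0_valZ h0 ind0 mulr0 addr0.
have [C C0 TC] := bT i; apply: (@scalars_eq0 _ _ _ C) => n.
set e := n.+1%:R^-1; have e0 : 0 < e by rewrite invr_gt0 ltr0n.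
have [N fN] := continuous_seq_lub (@C0_continuous _ _ f) e0 als.
(* The part of [h] up to [s N] has an image vanishing from [s N.+1] on, hence at [al]; the rest has
   norm at most [e]. *)
rewrite -(subrK (trunc (s N) h) h) linearD C0_valD.
have [_ /(_ i (trunc (s N) h)) -> //] := nextP (s N); last exact: sal N.+1.
  rewrite addr0 mulrC (le_trans (C0_val_le _ _))// (le_trans (TC _))//.
  rewrite ler_wpM2l//; apply: C0_le => y.
  rewrite C0_valB truncE; case: ifPn => [_|]; first by rewrite subrr normr0 ltW.
  rewrite -ltNge subr0 /h C0_valB C0_valZ truncE indE => sNy.
  case: leP => [yal|_]; last by rewrite mulr0 subr0 normr0 ltW.
  by rewrite mulr1 distrC ltW// fN// ltW.
by move=> y; rewrite truncE leNgt => ->.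
Qed.

Lemma sum_sparse_le (n : nat) (a : 'I_n -> K) (C : K) : 0 <= C ->
    (forall j l : 'I_n, (j < l)%N -> a j = 0 \/ a l = 0) ->
    (forall j, `|a j| <= C) -> `|\sum_j a j| <= C.
Proof.
move=> C0 asp aC; have [/existsP[j aj]|] := boolP [exists j, a j != 0].
  rewrite (bigD1 j)//= big1 ?addr0// => l lj; apply/eqP.
  move: lj; rewrite -val_eqE neq_ltn /= => /orP[] /asp [] a0.
  - by rewrite a0.
  - by rewrite a0 eqxx in aj.
  - by rewrite a0 eqxx in aj.
  - by rewrite a0.
rewrite negb_exists => /forallP a0; rewrite big1 ?normr0// => j _.
exact/eqP/negPn/a0.
Qed.

(* [f] averages the indicators of [N] intervals with a common point, chosen so *)
(* sparsely that their images essentially have disjoint supports. *)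
Lemma tail_zero_not_bounded_below (e : K) : 0 < e ->
  exists f, 1 <= `|f| /\ forall i, `|T i f| <= e.
Proof.
move=> e0; have [b bP] := tail_zero_start.
have [C [C0 TC]] : exists C : K, 0 <= C /\ forall i f, `|T i f| <= C * `|f|.
  have /choice[c cP] : forall i, exists c : K, 0 <= c /\ forall f, `|T i f| <= c * `|f|.
    by move=> i; have [c ? ?] := bT i; exists c.
  exists (\sum_i c i); split; first by apply: sumr_ge0 => i _; have [] := cP i.
  move=> i f; have [_ /(_ f) /le_trans] := cP i; apply; rewrite ler_wpM2r//.
  rewrite (bigD1 i)//= lerDl; apply: sumr_ge0 => j _; by have [] := cP j.
(* Beyond b, the images of the indicators up to g and up to any l >= h are never both nonzero. Up to
   b the images need not vanish, but they no longer depend on l, so differences cancel there. *)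
have /choice[next nextP] : forall g, exists h, (g < h)%O /\ forall l, (h <= l)%O ->
    (forall i x, (b <= x)%O ->
      val (T i (ind R k g)) x = 0 \/ val (T i (ind R k l)) x = 0) /\
    (forall i x, (x <= b)%O ->
      val (T i (ind R k l)) x = val (T i (ind R k h)) x).
  move=> g; have [s0 s0P] := family_head g.
  have [s [bs /ltW s0s]] := omega1_ubound2 b s0.
  have [t tP] := family_tail s; have [h [th gh]] := omega1_ubound2 t g.
  exists h; split=> // l hl; have tl := le_trans th hl.
  split=> i x.
    (* The point [s] separates the two images: that of [ind g] vanishes from [s] on, that of [ind l]
       between [b] and [s]. *)
    move=> bx; have [sx|xs] := leP s x.
      left; apply: (s0P i) => [y gy|]; last exact: le_trans sx.
      by rewrite indE leNgt gy.
    right; apply: (tail_zero_ind (bP i) (x := s)); last by rewrite bx ltW.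
    by move=> f fl; apply: tP => y yt; apply: fl; exact: le_trans tl.
  move=> xb; apply/eqP; rewrite -subr_eq0 -C0_valB -linearB; apply/eqP.
  apply: tP (le_trans xb bs) => z zt.
  by rewrite C0_valB !indE (le_trans zt tl) (le_trans zt th) subrr.
pose s n := iter n next b.
have s_lt n m : (n < m)%N -> (s n < s m)%O.
  elim: m => // m IH; rewrite ltnS leq_eqVlt => /predU1P[->|/IH/lt_trans].
    by have [] := nextP (s m).
  by apply; have [] := nextP (s m).
have s_le n m : (n <= m)%N -> (s n <= s m)%O.
  by rewrite leq_eqVlt => /predU1P[->//|/s_lt/ltW].
pose h i n : E := T i (ind R k (s n)).
have h_sparse i x n m : (b <= x)%O -> (n < m)%N -> val (h i n) x = 0 \/ val (h i m) x = 0.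
  by move=> bx nm; have [_ /(_ (s m) (s_le _ _ nm))[+ _]] := nextP (s n); apply.
have h_cst i x n : (x <= b)%O -> val (h i n.+1) x = val (h i 1%N) x.
  by move=> xb; have [_ /(_ (s n.+1) (s_le 1%N n.+1 isT))[_ +]] := nextP b; apply.
have h_le i x n : `|val (h i n) x| <= C.
  rewrite (le_trans (C0_val_le _ _))// (le_trans (TC _ _))//.
  by rewrite -[leRHS]mulr1 ler_wpM2l// ind_norm_le.
have [N] := @scalars_natr_bound R k ((C + C) / e) (divr_ge0 (addr_ge0 C0 C0) (ltW e0)).
rewrite ltr_pdivrMr// => CN.
have N0 : 0 < N%:R :> K.
  by rewrite ltr0n lt0n; apply: contraTneq CN => ->; rewrite mulr0n mul0r le_gtF ?addr_ge0.
(* The intervals from [s j.+1] (excluded) to [s (j.+1 + N)] all contain [s N.+1], where [f] is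
   therefore 1. Indices start at 1 because [h_cst] gives equal images up to [b] only from there on.
   Beyond [b] each of the two sums has at most one nonzero term, so the image is bounded by (C +
   C)/N < e. *)
pose f := N%:R^-1 *: (\sum_(j < N) (ind R k (s (j.+1 + N)%N)) -
                      \sum_(j < N) (ind R k (s j.+1))).
exists f; split.
  apply: le_trans (C0_val_le f (s N.+1)).
  rewrite C0_valZ C0_valB !C0_val_sum (eq_bigr (fun=> 1)); last first.
    by move=> j _; rewrite indE s_le// addSn ltnS leq_addl.
  rewrite [X in _ - X]big1 ?subr0; last first.
    by move=> j _; rewrite indE leNgt s_lt// ltnS.
  by rewrite sumr_const card_ord mulVf ?normr1// gt_eqF.
move=> i; apply: C0_le => x.
have -> : val (T i f) x = N%:R^-1 *
    (\sum_(j < N) val (h i (j.+1 + N)%N) x - \sum_(j < N) val (h i j.+1) x).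
  by rewrite linearZ C0_valZ linearB C0_valB !(linear_sum (T i)) !C0_val_sum.
have [xb|/ltW bx] := leP x b.
  rewrite -sumrB big1 ?mulr0 ?normr0 ?(ltW e0)// => j _.
  by rewrite addSn !h_cst// subrr.
rewrite normrM (ger0_norm (_ : 0 <= N%:R^-1)) ?invr_ge0 ?ler0n// ler_pdivrMl//.
apply: le_trans (ltW CN); rewrite (le_trans (ler_normB _ _))// lerD//.
  apply: sum_sparse_le => // j l jl; apply: h_sparse => //.
  by rewrite ltn_add2r ltnS.
by apply: sum_sparse_le => // j l jl; apply: h_sparse.
Qed.

End tail_zero.

(** * Coordinate maps and linear combinations on direct sums *)

Section direct_sum_operators.
Variables (K : numFieldType) (I : finType) (E : normedModType K).
Implicit Types (F : {ffun I -> E}) (v : I -> K).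

Definition ffun_proj (i : I) F : E := F i.

Lemma ffun_proj_linear i : linear (ffun_proj i).
Proof. by move=> a F G; rewrite /ffun_proj !ffunE. Qed.

HB.instance Definition _ i :=
  GRing.isLinear.Build K {ffun I -> E} E _ (ffun_proj i) (ffun_proj_linear i).

Definition ffun_comb v F : E := \sum_i v i *: F i.

Lemma ffun_comb_linear v : linear (ffun_comb v).
Proof.
move=> a F G; rewrite /ffun_comb scaler_sumr -big_split; apply: eq_bigr => i _ /=.
by rewrite !ffunE scalerDr !scalerA mulrC.
Qed.

HB.instance Definition _ v :=
  GRing.isLinear.Build K {ffun I -> E} E _ (ffun_comb v) (ffun_comb_linear v).

Definition ffun_scale v (f : E) : {ffun I -> E} := [ffun i => v i *: f].

Lemma ffun_scale_linear v : linear (ffun_scale v).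
Proof.
move=> a f g; apply/ffunP => i; rewrite !ffunE scalerDr !scalerA.
by rewrite mulrC.
Qed.

HB.instance Definition _ v :=
  GRing.isLinear.Build K E {ffun I -> E} _ (ffun_scale v) (ffun_scale_linear v).

Lemma ffun_scaleE v f : ffun_scale v f = \sum_i v i *: ffun_scale (fun j => (j == i)%:R) f.
Proof.
apply/ffunP => j; rewrite sum_ffunE (bigD1 j)//= big1 => [|i ij].
  by rewrite !ffunE eqxx scale1r addr0.
by rewrite !ffunE eq_sym (negbTE ij) scale0r scaler0.
Qed.

Lemma ffun_sumE F : F = \sum_i ffun_scale (fun j => (j == i)%:R) (F i).
Proof.
apply/ffunP => j; rewrite sum_ffunE (bigD1 j)//= big1 => [|i ij].
  by rewrite !ffunE eqxx scale1r addr0.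
by rewrite !ffunE eq_sym (negbTE ij) scale0r.
Qed.

Lemma norm_ffun_ge F i : `|F i| <= `|F|.
Proof. exact: ffun_norm_ge. Qed.

Lemma norm_ffun_le F (M : K) : 0 <= M -> (forall i, `|F i| <= M) -> `|F| <= M.
Proof. exact: ffun_norm_le. Qed.

End direct_sum_operators.

(** * Scalar matrices and comparison of the numbers of copies *)

Section bounded_operators.
Variables (R : realType) (k : scalar_kind).
Local Notation K := (scalars R k).
Local Notation E := (C0_omega1 R k).

Lemma linear_bounded_op (U V : normedModType K) (T : U -> V) :
  linear T -> continuous T -> bounded_op T.
Proof.
move=> Tlin Tc.
pose T' : {linear U -> V} := HB.pack T (GRing.isLinear.Build K U V _ T Tlin).
have /linear_bounded_continuous/linear_boundedP : continuous T' by [].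
by move=> /pinfty_ex_gt0[C C0 TC]; exists C => //; exact: ltW.
Qed.

Lemma bounded_op_comp (U V W : normedModType K) (S : V -> W) (T : U -> V) :
  bounded_op S -> bounded_op T -> bounded_op (S \o T).
Proof.
move=> [C C0 SC] [D D0 TD]; exists (C * D); first exact: mulr_ge0.
by move=> x; rewrite (le_trans (SC _))// -mulrA ler_wpM2l.
Qed.

Lemma ffun_proj_bounded (I : finType) (i : I) : bounded_op (@ffun_proj K I E i).
Proof. by exists 1 => // F; rewrite mul1r norm_ffun_ge. Qed.

Lemma ffun_comb_bounded (I : finType) (v : I -> K) : bounded_op (@ffun_comb K I E v).
Proof.
exists (\sum_i `|v i|); first exact: sumr_ge0.
move=> F; rewrite (le_trans (ler_norm_sum _ _ _))// mulr_suml ler_sum// => i _.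
by rewrite normrZ ler_wpM2l// norm_ffun_ge.
Qed.

Lemma ffun_scale_bounded (I : finType) (v : I -> K) : bounded_op (@ffun_scale K I E v).
Proof.
exists (\sum_i `|v i|); first exact: sumr_ge0.
move=> f; apply: norm_ffun_le => [|i]; first by rewrite mulr_ge0 ?sumr_ge0.
rewrite ffunE normrZ ler_wpM2r// (bigD1 i)//= lerDl.
exact: sumr_ge0.
Qed.

Lemma tail_scalar_comb (I : finType) (T : I -> {linear E -> E}) (c v : I -> K)
    (S : {linear E -> E}) : (forall i, tail_scalar (T i) (c i)) ->
  (forall f, S f = \sum_i v i *: T i f) -> tail_scalar S (\sum_i v i * c i).
Proof.
move=> Tc ST; have /choice[s sP] := Tc; have [b sb] := finite_ubound s.
exists b => x bx.
have /choice[t tP] := fun i => sP i x (le_trans (sb i) bx).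
have [g tg] := finite_ubound t; exists g => h gh.
rewrite ST C0_val_sum; apply: eq_bigr => i _.
by rewrite C0_valZ tP// (le_trans (tg i)).
Qed.

Lemma exists_left_null (F : fieldType) (p q : nat) (A : 'M[F]_(p, q)) :
  (q < p)%N -> exists2 w : 'rV_p, w != 0 & w *m A = 0.
Proof.
move=> qp; exists (nz_row (kermx A)).
  rewrite nz_row_eq0 kermx_eq0 /row_free; apply: contraTneq qp => <-.
  by rewrite -leqNgt rank_leq_col.
by apply/sub_kermxP; exact: nz_row_sub.
Qed.

(** If n < m, precomposing T with f |-> (v_i f)_i, for a left null vector v of the scalar matrix,
    gives n coordinate operators with scalar 0. They make some f of norm at least 1 almost
    vanish. *)
Lemma bounded_below_leq (m n : nat)
    (T : {linear {ffun 'I_m -> E} -> {ffun 'I_n -> E}}) (C : K) :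
  bounded_op T -> 0 <= C -> (forall F, `|F| <= C * `|T F|) -> (m <= n)%N.
Proof.
move=> bT C0 TC; rewrite leqNgt; apply/negP => nm.
pose S (v : 'I_m -> K) j : {linear E -> E} := @ffun_proj K 'I_n E j \o T \o ffun_scale v.
have bS v j : bounded_op (S v j).
  apply: bounded_op_comp; last exact: ffun_scale_bounded.
  by apply: bounded_op_comp bT; exact: ffun_proj_bounded.
have /choice[c cP] := fun ij : 'I_m * 'I_n =>
  tail_scalar_exists (bS (fun l => (l == ij.1)%:R) ij.2).
have [w w0 wc] := exists_left_null (\matrix_(i, j) c (i, j)) nm.
pose v i := w 0 i.
have [i0 vi0] : exists i, v i != 0.
  apply/existsP; apply: contra_neqT w0; rewrite negb_exists => /forallP v0.
  by apply/rowP => i; rewrite mxE; exact/eqP/negPn/v0.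
have S0 j : tail_scalar (S v j) 0.
  have <- : \sum_i v i * c (i, j) = 0.
    have /rowP/(_ j) := wc; rewrite !mxE => wcj; rewrite -[RHS]wcj.
    by apply: eq_bigr => i _; rewrite mxE.
  apply: tail_scalar_comb (fun i => cP (i, j)) _ => f.
  rewrite /S /= ffun_scaleE !linear_sum; apply: eq_bigr => i _.
  by rewrite !linearZ.
have C1 : 0 < C + 1 by rewrite ltr_wpDl.
have v0 : 0 < `|v i0| by rewrite normr_gt0.
(* The tolerance |v_i0| / (C + 1) is chosen so that C times it stays below |v_i0|, a lower bound for
   the norm of the vector (v_i f)_i. *)
have [f [f1 Sf]] := tail_zero_not_bounded_below (bS v) S0 (divr_gt0 v0 C1).
have := TC (ffun_scale v f); apply/negP; rewrite -real_ltNge ?normr_real//; last first.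
  by rewrite realM ?normr_real// ger0_real.
apply: (@lt_le_trans _ _ `|v i0|); last first.
  apply: le_trans (norm_ffun_ge _ i0); rewrite ffunE normrZ.
  by rewrite -[leLHS]mulr1 ler_wpM2l.
apply: (@le_lt_trans _ _ (C * (`|v i0| / (C + 1)))).
  rewrite ler_wpM2l//; apply: norm_ffun_le; first by rewrite divr_ge0 ?ltW.
  by move=> j; exact: Sf.
by rewrite mulrCA gtr_pMr// ltr_pdivrMr// mul1r ltrDl.
Qed.

(** Here the null vector v acts after T: the combination of the coordinates of T G with weights v_j
    vanishes at one point [al] for every G. An indicator up to [al] placed in a coordinate with v_j
    nonzero is then not attained. *)
Lemma surjective_leq (m n : nat)
    (T : {linear {ffun 'I_n -> E} -> {ffun 'I_m -> E}}) :
  bounded_op T -> (forall F, exists G, T G = F) -> (m <= n)%N.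
Proof.
move=> bT Tsurj; rewrite leqNgt; apply/negP => nm.
pose d (i : 'I_n) (j : 'I_n) : K := (j == i)%:R.
pose S j i : {linear E -> E} := @ffun_proj K 'I_m E j \o T \o ffun_scale (d i).
have bS j i : bounded_op (S j i).
  apply: bounded_op_comp; last exact: ffun_scale_bounded.
  by apply: bounded_op_comp bT; exact: ffun_proj_bounded.
have /choice[c cP] := fun ji : 'I_m * 'I_n => tail_scalar_exists (bS ji.1 ji.2).
have [w w0 wc] := exists_left_null (\matrix_(j, i) c (j, i)) nm.
pose v j := w 0 j.
have [j0 vj0] : exists j, v j != 0.
  apply/existsP; apply: contra_neqT w0; rewrite negb_exists => /forallP v0.
  by apply/rowP => i; rewrite mxE; exact/eqP/negPn/v0.
pose P i : {linear E -> E} := @ffun_comb K 'I_m E v \o T \o ffun_scale (d i).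
have bP i : bounded_op (P i).
  apply: bounded_op_comp; last exact: ffun_scale_bounded.
  by apply: bounded_op_comp bT; exact: ffun_comb_bounded.
have P0 i : tail_scalar (P i) 0.
  have <- : \sum_j v j * c (j, i) = 0.
    have /rowP/(_ i) := wc; rewrite !mxE => wci; rewrite -[RHS]wci.
    by apply: eq_bigr => j _; rewrite mxE.
  exact: tail_scalar_comb (fun j => cP (j, i)) _.
have [al alP] := tail_zero_common_zero bP P0.
have [G TG] := Tsurj (ffun_scale (fun j => (j == j0)%:R) (ind R k al)).
have : val (ffun_comb v (T G)) al = 0.
  have -> : ffun_comb v (T G) = \sum_i P i (G i).
    by rewrite {1}(ffun_sumE G) !linear_sum.
  by rewrite C0_val_sum big1.
have -> : ffun_comb v (T G) = v j0 *: ind R k al.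
  rewrite TG /ffun_comb (bigD1 j0)//= big1 => [|j jj0].
    by rewrite addr0 ffunE eqxx scale1r.
  by rewrite ffunE (negbTE jj0) scale0r scaler0.
by rewrite C0_valZ indE lexx mulr1; exact/eqP.
Qed.

End bounded_operators.

(** * From subspaces and quotients to operators *)

Theorem corollary1p8 (R : realType) (k : scalar_kind) (m n : nat)
    (m_gt0 : (0 < m)%N) (n_gt0 : (0 < n)%N)
    (embeds_or_quotient :
      (exists S : closed_subspace (C0_omega1_sum R k n),
         isomorphic (C0_omega1_sum R k m) (subspace_type S)) \/
      (exists S : closed_subspace (C0_omega1_sum R k n),
         isomorphic (C0_omega1_sum R k m) (quotient_type S))) :
  (m <= n)%N.
Proof.
have inv_linear (U V : normedModType (scalars R k)) (f : {linear U -> V}) (g : V -> U) :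
    cancel f g -> cancel g f -> linear g.
  by move=> fg gf a x y; apply: (can_inj fg); rewrite linearP !gf.
case: embeds_or_quotient => [[S [f [g [fg gf fc gc]]]]|[S [f [g [fg gf fc gc]]]]].
  have [C C0 gC] := linear_bounded_op (inv_linear _ _ _ _ fg gf) gc.
  have [D D0 fD] := linear_bounded_op (@linearP _ _ _ _ f) fc.
  (* The inclusion [val] is isometric, so boundedness of the inverse [g] says that [T] is bounded
     below. *)
  pose T : {linear C0_omega1_sum R k m -> C0_omega1_sum R k n} := val \o f.
  apply: (@bounded_below_leq R k m n T C) => //; first by exists D.
  by move=> F; rewrite -{1}[F]fg; exact: gC.
have [C C0 gC] := linear_bounded_op (inv_linear _ _ _ _ fg gf) gc.
pose p (F : C0_omega1_sum R k n) : quotient_type S := \pi_(quotient_type S)%qT F.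
have p_linear : linear p.
  move=> a F G; rewrite /p quotient_piD; congr (_ + _).
  by rewrite -quotient_scale_pi.
have g_linear := inv_linear _ _ _ _ fg gf.
have Tlin : linear (g \o p) by move=> a F G; rewrite /= p_linear g_linear.
(* The projection followed by the inverse isomorphism is surjective, and bounded since the
   projection does not increase norms. *)
pose T : {linear C0_omega1_sum R k n -> C0_omega1_sum R k m} :=
  HB.pack (g \o p) (GRing.isLinear.Build _ _ _ _ (g \o p) Tlin).
apply: (@surjective_leq R k m n T).
  exists C => // F; rewrite (le_trans (gC _))// ler_wpM2l//.
  exact: quotient_norm_le.
move=> F; exists (repr (f F)).
by rewrite /= /p reprK fg.
Qed.
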